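(* Let $K$ be a commutative field, let $(\mathcal{C}^{\bullet},F,\tau,\phi)$ be an enhanced 2-cosemisimplicial object in the 2-category $\mathbf{Cat}_K$ of small $K$-linear categories, and let $X$ be an object of $\mathcal{C}^0$. For every $n\ge 1$ choose $n$-tuples $(\mu^n_1,\ldots,\mu^n_n)$ and $(\nu^n_1,\ldots,\nu^n_n)$ with $\mu^n_q,\nu^n_q\in\{0,\ldots,q\}$, and let $X_n,X'_n$ be the corresponding reference objects of $\mathcal{C}^n$, and $\alpha^{\phi}_{i,n},\beta^{\phi}_{i,n}$ the corresponding isomorphisms (all defined in the context). Put $M^n:=\mathrm{Hom}_{\mathcal{C}^n}(X_n,X'_n)$ for $n\geq 1$. Then the $K$-modules $M^1,M^2,\ldots$ together with the maps $\delta:M^{n-1}\to M^n$, $n\geq 2$, given by $$\delta(\varphi)=\sum_{i=0}^n(-1)^i\,\alpha^{\phi}_{i,n}\circ F^i_n(\varphi)\circ\beta^{\phi}_{i,n}$$ define a cochain complex. Furthermore, the cochain complexes defined in this way by different choices of the reference objects $X_n,X'_n$, $n\ge 1$ (i.e. of the tuples $\mu^n,\nu^n$), and by different objects $Y$ of $\mathcal{C}^0$ isomorphic to $X$, are all isomorphic.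
   Context: $\mathbf{Cat}_K$ is the 2-category with objects the small $K$-linear categories (categories enriched in $K$-vector spaces), 1-morphisms the $K$-linear functors, 2-morphisms the natural transformations. Vertical composition of 2-morphisms is written $\cdot$, horizontal composition and composition of 1-morphisms $\circ$. A 2-cosemisimplicial object $(X^{\bullet},\partial,\tau)$ in a 2-category consists of objects $X^0,X^1,\ldots$, 1-morphisms $\partial^i_n:X^{n-1}\to X^n$ ($0\le i\le n$, $n\geq 1$), and 2-isomorphisms $\tau^n_{ij}:\partial^j_{n+1}\circ\partial^i_n\Rightarrow\partial^i_{n+1}\circ\partial^{j-1}_n$ ($0\leq i<j\leq n+1$, $n\ge1$), such that for all $n\geq 1$, $0\leq i<j<k\leq n+2$, $$(1_{\partial^i_{n+2}}\circ\tau^n_{j-1,k-1})\cdot(\tau^{n+1}_{ik}\circ 1_{\partial^{j-1}_n})\cdot(1_{\partial^k_{n+2}}\circ\tau^n_{ij})=(\tau^{n+1}_{ij}\circ 1_{\partial^{k-2}_n})\cdot(1_{\partial^j_{n+2}}\circ\tau^n_{i,k-1})\cdot(\tau^{n+1}_{jk}\circ 1_{\partial^i_n}).$$ It is enhanced if it is equipped with a 2-isomorphism $\phi:\partial^1_1\Rightarrow\partial^0_1$ such that $$\tau^1_{0,1}\cdot(1_{\partial_2^1}\circ\phi)\cdot\tau^1_{1,2}=(1_{\partial_2^0}\circ\phi)\cdot\tau^1_{0,2}\cdot(1_{\partial_2^2}\circ\phi).$$ For $\mathcal{C}^{\bullet}$ in $\mathbf{Cat}_K$ the coface maps are functors denoted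 $F^i_n:\mathcal{C}^{n-1}\to\mathcal{C}^n$. Write $F_1^{i_1,\ldots,i_n}:=F^{i_n}_n\circ\cdots\circ F^{i_1}_1:\mathcal{C}^0\to\mathcal{C}^n$ for tuples with $0\le i_q\le q$. Canonical enhanced 2-isomorphisms: for any two such tuples $(i_1,\ldots,i_n)$, $(j_1,\ldots,j_n)$ there is exactly one natural isomorphism $\tau^{\phi}_{(i_1,\ldots,i_n),(j_1,\ldots,j_n)}:F_1^{i_1,\ldots,i_n}\Rightarrow F_1^{j_1,\ldots,j_n}$ that is a (possibly empty) vertical composite, along a sequence of tuples from the first to the second, of 2-morphisms $1_{f'}\circ\tau^m_{ij}\circ 1_f$ (with $f,f'$ composites of coface functors), 2-morphisms $1_f\circ\phi$, and inverses of these. Reference objects: $X_n:=F_1^{\mu^n_1,\ldots,\mu^n_n}(X)$ and $X'_n:=F_1^{\nu^n_1,\ldots,\nu^n_n}(X)$. For $n\ge 2$ and $0\le i\le n$, $$\alpha^{\phi}_{i,n}:=\left(\tau^{\phi}_{(\nu^{n-1}_1,\ldots,\nu^{n-1}_{n-1},i),(\nu^n_1,\ldots,\nu^n_n)}\right)_X:F^i_n(X'_{n-1})\to X'_n,$$ $$\beta^{\phi}_{i,n}:=\left(\tau^{\phi}_{(\mu^n_1,\ldots,\mu^n_n),(\mu^{n-1}_1,\ldots,\mu^{n-1}_{n-1},i)}\right)_X:X_n\to F^i_n(X_{n-1}).$$ *)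

(* Defs.v *)
From mathcomp Require Import all_boot all_order all_algebra.
From Stdlib Require Import IndefiniteDescription.

Set Implicit Arguments.
Unset Strict Implicit.
Unset Printing Implicit Defensive.

Import GRing.Theory.
Local Open Scope ring_scope.

Reserved Notation "g \oc f" (at level 50, left associativity).

Record klincat (K : fieldType) := KLinCat {
  obj :> Type;
  hom : obj -> obj -> lmodType K;
  idm : forall x, hom x x;
  comp : forall x y z, hom y z -> hom x y -> hom x z;
  compA : forall x y z t (h : hom z t) (g : hom y z) (f : hom x y),
    comp h (comp g f) = comp (comp h g) f;
  comp1m : forall x y (f : hom x y), comp (idm y) f = f;
  compm1 : forall x y (f : hom x y), comp f (idm x) = f;
  comp_linear_l : forall x y z (f : hom x y),
    linear (fun g : hom y z => comp g f);
  comp_linear_r : forall x y z (g : hom y z),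
    linear (fun f : hom x y => comp g f)
}.
Arguments idm {K k} x.
Arguments comp {K k x y z} g f.
Notation "g \oc f" := (comp g f) : ring_scope.

Definition mutually_inverse (K : fieldType) (A : klincat K) (x y : A)
    (f : hom x y) (g : hom y x) : Prop :=
  g \oc f = idm x /\ f \oc g = idm y.

Definition isomorphic (K : fieldType) (A : klincat K) (x y : A) : Prop :=
  exists (f : hom x y) (g : hom y x), mutually_inverse f g.

Record klinfunctor (K : fieldType) (A B : klincat K) := KLinFunctor {
  fobj :> A -> B;
  fmap : forall x y : A, hom x y -> hom (fobj x) (fobj y);
  fmap1 : forall x, fmap (idm x) = idm (fobj x);
  fmapM : forall x y z (g : hom y z) (f : hom x y),
    fmap (g \oc f) = fmap g \oc fmap f;
  fmap_linear : forall x y, linear (@fmap x y)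
}.
Arguments fmap {K A B} k {x y} f.

Section Functors.
Variables (K : fieldType).

Definition idF (A : klincat K) : klinfunctor A A.
Proof.
by refine (@KLinFunctor K A A (fun x => x) (fun x y f => f) _ _ _).
Defined.

Definition compF (A B C : klincat K) (G : klinfunctor B C)
  (F : klinfunctor A B) : klinfunctor A C.
Proof.
refine (@KLinFunctor K A C (fun x => G (F x))
  (fun x y f => fmap G (fmap F f)) _ _ _).
- by move=> x; rewrite !fmap1.
- by move=> x y z g f; rewrite !fmapM.
- by move=> x y a f g; rewrite !fmap_linear.
Defined.

(* Families of components, with naturality imposed separately: the types below
   depend only on the object maps of the functors, so that composition of
   functors is strictly associative and unital as far as they can see. *)
Definition transf (A B : klincat K) (F G : klinfunctor A B) :=
  forall x : A, hom (F x) (G x).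

Definition natural (A B : klincat K) (F G : klinfunctor A B)
    (a : transf F G) : Prop :=
  forall (x y : A) (f : hom x y), a y \oc fmap F f = fmap G f \oc a x.

Definition transf_inverse (A B : klincat K) (F G : klinfunctor A B)
    (a : transf F G) (b : transf G F) : Prop :=
  forall x, mutually_inverse (a x) (b x).

Record natiso (A B : klincat K) (F G : klinfunctor A B) := NatIso {
  ni_fun :> transf F G;
  ni_natural : natural ni_fun;
  ni_iso : exists b : transf G F, natural b /\ transf_inverse ni_fun b
}.

Definition idT (A B : klincat K) (F : klinfunctor A B) : transf F F :=
  fun x => idm (F x).

Definition vcomp (A B : klincat K) (F G H : klinfunctor A B)
    (b : transf G H) (a : transf F G) : transf F H :=
  fun x => b x \oc a x.

(* whiskl G a is 1_G o a, and whiskr a E is a o 1_E. *)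
Definition whiskl (A B C : klincat K) (G : klinfunctor B C)
    (F F' : klinfunctor A B) (a : transf F F') :
    transf (compF G F) (compF G F') :=
  fun x => fmap G (a x).

Definition whiskr (A B C : klincat K) (F F' : klinfunctor B C)
    (a : transf F F') (E : klinfunctor A B) :
    transf (compF F E) (compF F' E) :=
  fun x => a (E x).

End Functors.

(* [coface n i] is the coface functor with upper index i from C^n to C^{n+1}
   (lower index n+1), for 0 <= i <= n+1; [tau n i j] is tau^{n+1}_{ij} and
   [tau_cocycle] at n is the identity between transformations of functors
   C^n -> C^{n+3}. As [coface] takes an ordinal while the indices are shifted
   as natural numbers, they are injected with [inord], always in range. The six
   range hypotheses of [tau_cocycle] amount together to i < j < k <= n+3. *)
Record cosemi2 (K : fieldType) := CoSemi2 {
  cat :> nat -> klincat K;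
  coface : forall n, 'I_n.+2 -> klinfunctor (cat n) (cat n.+1);
  tau : forall n i j : nat, (i < j <= n.+2)%N ->
    natiso (compF (@coface n.+1 (inord j)) (@coface n (inord i)))
           (compF (@coface n.+1 (inord i)) (@coface n (inord j.-1)));
  tau_cocycle : forall (n i j k : nat)
      (ij : (i < j <= n.+2)%N) (ik1 : (i < k.-1 <= n.+2)%N)
      (jk1 : (j.-1 < k.-1 <= n.+2)%N) (ij' : (i < j <= n.+3)%N)
      (ik : (i < k <= n.+3)%N) (jk : (j < k <= n.+3)%N) (x : cat n),
    vcomp (whiskl (@coface n.+2 (inord i)) (tau jk1))
      (vcomp (whiskr (tau ik) (@coface n (inord j.-1)))
             (whiskl (@coface n.+2 (inord k)) (tau ij))) x
    = vcomp (whiskr (tau ij') (@coface n (inord k.-2)))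
        (vcomp (whiskl (@coface n.+2 (inord j)) (tau ik1))
               (whiskr (tau jk) (@coface n (inord i)))) x
}.
Arguments coface {K} c n i.
Arguments tau {K} c {n i j} _.

Record enhanced_cosemi2 (K : fieldType) := EnhancedCoSemi2 {
  base :> cosemi2 K;
  phi : natiso (coface base 0 (inord 1)) (coface base 0 (inord 0));
  phi_hexagon : forall x : base 0%N,
    vcomp (@tau K base 0 0 1 isT)
      (vcomp (whiskl (coface base 1 (inord 1)) phi) (@tau K base 0 1 2 isT)) x
    = vcomp (whiskl (coface base 1 (inord 0)) phi)
        (vcomp (@tau K base 0 0 2 isT)
               (whiskl (coface base 1 (inord 2)) phi)) x
}.

(* Tuples (i_1, ..., i_n) with 0 <= i_q <= q, as left-nested pairs. *)
Fixpoint ctuple (n : nat) : Type :=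
  if n is m.+1 then (ctuple m * 'I_m.+2)%type else unit.

Section Canonical.
Variables (K : fieldType) (C : enhanced_cosemi2 K).

Fixpoint cofaces (n : nat) : ctuple n -> klinfunctor (C 0%N) (C n) :=
  if n is m.+1
  then fun s : ctuple m.+1 => compF (coface C m s.2) (cofaces s.1)
  else fun _ => idF (C 0%N).

(* The 2-morphisms 1_{f'} o tau o 1_f and 1_{f'} o phi; the outer functor f' is
   built up one coface functor at a time. *)
Inductive elementary : forall (n : nat) (s t : ctuple n),
    transf (cofaces s) (cofaces t) -> Prop :=
| elem_tau (n i j : nat) (s : ctuple n) (ij : (i < j <= n.+2)%N) :
    @elementary n.+2 ((s, inord i), inord j) ((s, inord j.-1), inord i)
      (whiskr (tau C ij) (cofaces s))
| elem_phi : @elementary 1 (tt, inord 1) (tt, inord 0) (phi C)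
| elem_whisk (n : nat) (s t : ctuple n) (a : transf (cofaces s) (cofaces t))
    (i : 'I_n.+2) :
    elementary a ->
    @elementary n.+1 (s, i) (t, i) (whiskl (coface C n i) a).

Inductive canonical (n : nat) (s : ctuple n) : forall t : ctuple n,
    transf (cofaces s) (cofaces t) -> Prop :=
| canon_id : canonical (@idT K _ _ (cofaces s))
| canon_step (t u : ctuple n) (a : transf (cofaces s) (cofaces t))
    (b : transf (cofaces t) (cofaces u)) :
    canonical a -> elementary b -> canonical (vcomp b a)
| canon_stepV (t u : ctuple n) (a : transf (cofaces s) (cofaces t))
    (b : transf (cofaces u) (cofaces t)) (b' : transf (cofaces t) (cofaces u)) :
    canonical a -> elementary b -> transf_inverse b b' ->
    canonical (vcomp b' a).

Lemma mutually_inverse_comp (A : klincat K) (x y z : A) (f : hom x y)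
    (f' : hom y x) (g : hom y z) (g' : hom z y) :
  mutually_inverse f f' -> mutually_inverse g g' ->
  mutually_inverse (g \oc f) (f' \oc g').
Proof.
move=> [f'f ff'] [g'g gg']; split.
  by rewrite -compA (compA g') g'g comp1m.
by rewrite -compA (compA f) ff' comp1m.
Qed.

Lemma natural_inverse (A B : klincat K) (F G : klinfunctor A B)
    (a : transf F G) (b : transf G F) :
  natural a -> transf_inverse a b -> natural b.
Proof.
move=> nat_a ab x y f.
rewrite -[LHS]compm1 -(ab x).2 -compA (compA (fmap G f)) -nat_a -compA compA.
by rewrite (ab y).1 comp1m.
Qed.

Lemma elementary_iso (n : nat) (s t : ctuple n)
    (a : transf (cofaces s) (cofaces t)) :
  elementary a -> natural a /\ exists b, transf_inverse a b.
Proof.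
elim=> {n s t a} [n i j s ij | | n s t a i _ [nat_a [b ab]]].
- have [b [_ ab]] := ni_iso (tau C ij); split.
    by move=> x y f; apply: (ni_natural (tau C ij)).
  by exists (fun x => b (cofaces s x)) => x; apply: ab.
- have [b [_ ab]] := ni_iso (phi C); split; last by exists b.
  by move=> x y f; apply: (ni_natural (phi C)).
- split.
    move=> x y f; rewrite [LHS](esym (fmapM (coface C n i) _ _)) nat_a.
    by rewrite fmapM.
  exists (whiskl (coface C n i) b) => x; split.
    by rewrite [LHS](esym (fmapM (coface C n i) _ _)) (ab x).1; rewrite fmap1.
  by rewrite [LHS](esym (fmapM (coface C n i) _ _)) (ab x).2; rewrite fmap1.
Qed.

Lemma canonical_iso (n : nat) (s t : ctuple n)
    (a : transf (cofaces s) (cofaces t)) :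
  canonical a -> natural a /\ exists b, transf_inverse a b.
Proof.
have vcomp_iso (u v w : ctuple n) (c : transf (cofaces u) (cofaces v))
    (d : transf (cofaces v) (cofaces w)) :
    natural c /\ (exists b, transf_inverse c b) ->
    natural d /\ (exists b, transf_inverse d b) ->
    natural (vcomp d c) /\ exists b, transf_inverse (vcomp d c) b.
  move=> [nat_c [c' cc']] [nat_d [d' dd']]; split.
    by move=> x y f; rewrite /vcomp -compA nat_c compA nat_d -compA.
  by exists (vcomp c' d') => x; apply: mutually_inverse_comp.
elim=> {t a} [|t u a b _ IHa /elementary_iso b_iso|t u a b b' _ IHa].
- split; first by move=> x y f; rewrite /idT comp1m compm1.
  by exists (@idT K _ _ (cofaces s)) => x; split; rewrite /idT comp1m.
- exact: vcomp_iso.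
- move=> /elementary_iso[nat_b _] bb'; apply: vcomp_iso => //.
  split; first exact: natural_inverse nat_b bb'.
  by exists b => x; split; case: (bb' x).
Qed.

Let linked (n : nat) (s t : ctuple n) : Prop :=
  exists a : transf (cofaces s) (cofaces t), canonical a.

Let linked_step n (s t u : ctuple n) (b : transf (cofaces t) (cofaces u)) :
  linked s t -> elementary b -> linked s u.
Proof. by move=> [a can_a] el_b; exists (vcomp b a); apply: canon_step. Qed.

Let linked_stepV n (s t u : ctuple n) (b : transf (cofaces u) (cofaces t)) :
  linked s t -> elementary b -> linked s u.
Proof.
move=> [a can_a] el_b; have [_ [b' bb']] := elementary_iso el_b.
by exists (vcomp b' a); apply: canon_stepV can_a el_b bb'.
Qed.

Let linked_refl n (s : ctuple n) : linked s s.
Proof. by exists (@idT K _ _ (cofaces s)); apply: canon_id. Qed.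

Let linked_trans n (s t u : ctuple n) :
  linked s t -> linked t u -> linked s u.
Proof.
move=> st [c can_c]; elim: can_c => {u c} // [v u c b _ sv el_b|v u c b b' _ sv].
  exact: linked_step sv el_b.
by move=> el_b _; apply: linked_stepV sv el_b.
Qed.

Let linked_sym n (s t : ctuple n) : linked s t -> linked t s.
Proof.
move=> [c can_c]; elim: can_c => {t c} // [v u c b _ vs el_b|v u c b b' _ vs].
  by apply: linked_trans vs; apply: linked_stepV el_b; apply: linked_refl.
by move=> el_b _; apply: linked_trans vs; apply: linked_step el_b;
   apply: linked_refl.
Qed.

Let linked_whisk n (s t : ctuple n) (i : 'I_n.+2) :
  linked s t -> @linked n.+1 (s, i) (t, i).
Proof.
move=> [c can_c]; elim: can_c => {t c} // [v u c b _ sv el_b|v u c b b' _ sv].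
  exact: linked_step sv (elem_whisk i el_b).
by move=> el_b _; apply: linked_stepV sv (elem_whisk i el_b).
Qed.

Let ctuple0 : forall n, ctuple n :=
  fix z n := if n is m.+1 return ctuple n then (z m, inord 0) else tt.

Let linked0 n (s : ctuple n) : linked s (ctuple0 n).
Proof.
elim: n s => [[]|n IHn [s i]]; first exact: linked_refl.
have [->|i_neq0] := eqVneq i (inord 0); first exact/linked_whisk/IHn.
have i_gt0 : (0 < i)%N.
  by rewrite lt0n; apply: contraNneq i_neq0 => i0; rewrite -i0 inord_val.
apply: linked_trans (linked_whisk i (IHn s)) _.
case: n IHn {s} i i_neq0 i_gt0 => [|n] IHn i i_neq0 i_gt0.
  have -> : i = inord 1.
    by apply/val_inj; rewrite /= inordK //; case: i i_gt0 {i_neq0} => [[|[|]]].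
  exact: linked_step (linked_refl _) elem_phi.
have i_in : (0 < i <= n.+2)%N by rewrite i_gt0 -ltnS ltn_ord.
have := linked_step (linked_refl _) (elem_tau (ctuple0 n) i_in).
rewrite inord_val => ij; apply: linked_trans ij _.
exact/linked_whisk/IHn.
Qed.

Lemma canonical_exists (n : nat) (s t : ctuple n) :
  exists a : natiso (cofaces s) (cofaces t), canonical a.
Proof.
have [a can_a] : linked s t.
  by apply: linked_trans (linked0 s) (linked_sym (linked0 t)).
have [nat_a [b ab]] := canonical_iso can_a.
suff a_iso : exists b, natural b /\ transf_inverse a b.
  by exists (NatIso nat_a a_iso).
by exists b; split=> //; apply: natural_inverse nat_a ab.
Qed.

(* Canonical isomorphisms with given source and target are unique, by coherence,
   so that [tauphi] does not depend on the choice made here. *)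
Definition tauphi (n : nat) (s t : ctuple n) :
    natiso (cofaces s) (cofaces t) :=
  proj1_sig (constructive_indefinite_description _ (canonical_exists s t)).

Lemma tauphiP (n : nat) (s t : ctuple n) : canonical (tauphi s t).
Proof. by rewrite /tauphi; case: constructive_indefinite_description. Qed.

Section Complex.
Variables (X : C 0%N) (mu nu : forall n, ctuple n).

Definition refobj (s : forall n, ctuple n) (n : nat) : C n := cofaces (s n) X.

Definition refhom (n : nat) : lmodType K := hom (refobj mu n) (refobj nu n).

(* [alpha n i] and [beta n i] are alpha_{i,n+2} and beta_{i,n+2}; [delta] at n is
   the differential M^{n+1} -> M^{n+2}. *)
Definition alpha (n : nat) (i : 'I_n.+3) :
    hom (coface C n.+1 i (refobj nu n.+1)) (refobj nu n.+2) :=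
  ni_fun (@tauphi n.+2 (nu n.+1, i) (nu n.+2)) X.

Definition beta (n : nat) (i : 'I_n.+3) :
    hom (refobj mu n.+2) (coface C n.+1 i (refobj mu n.+1)) :=
  ni_fun (@tauphi n.+2 (mu n.+2) (mu n.+1, i)) X.

Definition delta (n : nat) (f : refhom n.+1) : refhom n.+2 :=
  \sum_(i < n.+3)
    (-1) ^+ i *: (alpha i \oc fmap (coface C n.+1 i) f \oc beta i).

End Complex.
End Canonical.

Arguments refhom {K C} X mu nu n.
Arguments delta {K C} X mu nu n f.

Section Cochain.
Variable K : fieldType.

Definition is_cochain_complex (M : nat -> lmodType K)
    (d : forall n, M n -> M n.+1) : Prop :=
  (forall n, linear (d n)) /\ (forall n (f : M n), d n.+1 (d n f) = 0).

Definition cochain_isomorphic (M : nat -> lmodType K)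
    (d : forall n, M n -> M n.+1) (N : nat -> lmodType K)
    (e : forall n, N n -> N n.+1) : Prop :=
  exists h : forall n, {linear M n -> N n},
    (forall n, bijective (h n)) /\
    (forall n (f : M n), h n.+1 (d n f) = e n (h n f)).

End Cochain.

(* Main.v *)
(* Every canonical isomorphism is determined by its end points. Contracting the
   coface indices of a tuple to 0 one after the other, by tau_{0j} and phi,
   gives an explicit isomorphism N_s from the functor of the tuple s to that of
   (0, ..., 0); the cocycle identity and, in lowest degree, the hexagon for phi
   say that N_t o a = N_s for each elementary 2-morphism a from s to t, hence
   for each canonical one, and N_t is monic. So canonical isomorphisms form a
   coherent system, natural in the object of C^0. The differential squares to
   zero because the term of index (i, j) is conjugated by tau_{ij} to that of
   index (j - 1, i), and conjugation by the canonical isomorphisms between the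
   reference objects commutes with the differentials. *)
From HB Require Import structures.
From mathcomp Require Import all_boot all_order all_algebra.
From mathcomp Require Import zify.
Require Import Defs.

Set Implicit Arguments.
Unset Strict Implicit.
Unset Printing Implicit Defensive.

Import GRing.Theory.
Local Open Scope ring_scope.

(** * Families over ordinals and alternating double sums *)

Lemma inord_family_ord (n : nat) (T : 'I_n.+1 -> Type)
    (p : forall k : nat, T (inord k)) :
  {q : forall i, T i | forall k, (k <= n)%N -> q (inord k) = p k}.
Proof.
exists (fun i => ecast i (T i) (inord_val i) (p i)) => k le_kn.
suff cast_p l (e : inord l = inord k) : l = k -> ecast i (T i) e (p l) = p k.
  by apply: cast_p; rewrite inordK.
(* Once the two indices agree, [e] is an equality of an ordinal with itself, and such proofs are
   unique, so the cast is trivial. *)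
by move=> l_k; move: e; rewrite l_k => e; rewrite eq_axiomK.
Qed.

(** For [i <= j] the values at [(i, j + 1)] and [(j, i)] agree and carry opposite signs; these pairs
    exhaust the double sum. *)
Lemma sum_cosimplicial_eq0 (K : pzRingType) (V : lmodType K) (m : nat)
    (G : 'I_m -> 'I_m.+1 -> V) :
  (forall i j : 'I_m, (i <= j)%N ->
     G i (lift ord0 j) = G j (widen_ord (leqnSn m) i)) ->
  \sum_(j < m.+1) \sum_(i < m) (-1) ^+ (i + j) *: G i j = 0.
Proof.
move=> G_swap.
have split_sum (j : 'I_m.+1) : \sum_(i < m) (-1) ^+ (i + j) *: G i j =
    \sum_(i < m | (i < j)%N) (-1) ^+ (i + j) *: G i j +
    \sum_(i < m | ~~ (i < j)%N) (-1) ^+ (i + j) *: G i j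
  by rewrite [LHS](bigID (fun i : 'I_m => (i < j)%N)).
rewrite (eq_bigr _ (fun j _ => split_sum j)) big_split /=.
(* [j = 0] contributes nothing to the first sum and [j = m] nothing to the second, so both outer
   sums run over ['I_m]. *)
rewrite big_ord_recl big1 ?add0r //.
rewrite [X in _ + X]big_ord_recr /= [X in _ + (_ + X)]big1 ?addr0; last first.
  by move=> i; rewrite ltn_ord.
rewrite [X in _ + X](exchange_big_dep xpredT) //= -big_split big1 // => j _ /=.
rewrite (eq_bigl (fun i : 'I_m => (i <= j)%N)); last by move=> i; rewrite /bump.
rewrite [X in _ + X](eq_bigl (fun i : 'I_m => (i <= j)%N)); last first.
  by move=> i; rewrite -leqNgt.
rewrite -big_split big1 // => i le_ij /=.
by rewrite G_swap // /bump addnS exprS mulN1r scaleNr addnC addNr.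
Qed.

(** * Two-sided composition as a linear map *)

Section Sandwich.
Variables (K : fieldType) (A : klincat K).

Lemma mutually_inverse_mono (x y z : A) (m : hom y z) (m' : hom z y)
    (f g : hom x y) :
  mutually_inverse m m' -> m \oc f = m \oc g -> f = g.
Proof.
by move=> [m'm _] mfg; rewrite -(comp1m f) -m'm -compA mfg compA m'm comp1m.
Qed.

Definition sandwich (x y z t : A) (a : hom z t) (b : hom x y) (f : hom y z) :
  hom x t := a \oc f \oc b.

Lemma sandwich_is_linear (x y z t : A) (a : hom z t) (b : hom x y) :
  linear (sandwich a b).
Proof. by move=> k f g; rewrite /sandwich comp_linear_r comp_linear_l. Qed.

HB.instance Definition _ (x y z t : A) (a : hom z t) (b : hom x y) :=
  GRing.isLinear.Build K (hom y z) (hom x t) _ (sandwich a b)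
    (sandwich_is_linear a b).

Lemma sandwich_comp (x y z t u v : A) (a' : hom t v) (a : hom z t)
    (b : hom x y) (b' : hom u x) (f : hom y z) :
  sandwich a' b' (sandwich a b f) = sandwich (a' \oc a) (b \oc b') f.
Proof. by rewrite /sandwich !compA. Qed.

End Sandwich.

HB.instance Definition _ (K : fieldType) (A B : klincat K)
    (F : klinfunctor A B) (x y : A) :=
  GRing.isLinear.Build K (hom x y) (hom (F x) (F y)) _ (@fmap K A B F x y)
    (@fmap_linear K A B F x y).

Lemma fmap_sandwich (K : fieldType) (A B : klincat K) (F : klinfunctor A B)
    (x y z t : A) (a : hom z t) (b : hom x y) (f : hom y z) :
  fmap F (sandwich a b f) = sandwich (fmap F a) (fmap F b) (fmap F f).
Proof. by rewrite /sandwich !fmapM. Qed.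

(** * Coherence of the canonical isomorphisms *)

Section Coherence.
Variables (K : fieldType) (C : enhanced_cosemi2 K).

Fixpoint zero_tuple (n : nat) : ctuple n :=
  if n is m.+1 then (zero_tuple m, inord 0) else tt.

(* The coface functors and tau indexed by arbitrary natural numbers, with junk
   value 0 for tau out of range, to be able to recurse on the indices. *)
Local Notation F n i := (coface C n (inord i)).

Definition tau_nat (n i j : nat) (x : C n) :
    hom (F n.+1 j (F n i x)) (F n.+1 i (F n j.-1 x)) :=
  if @idP (i < j <= n.+2)%N is ReflectT ij then ni_fun (tau C ij) x else 0.

Lemma tau_natE (n i j : nat) (ij : (i < j <= n.+2)%N) (x : C n) :
  tau_nat i j x = ni_fun (tau C ij) x.
Proof.
rewrite /tau_nat; case: {-}_ / idP => // ij'.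
by rewrite (bool_irrelevance ij ij').
Qed.

Lemma tau_nat_natural (n i j : nat) (x y : C n) (f : hom x y) :
  (i < j <= n.+2)%N ->
  tau_nat i j y \oc fmap (F n.+1 j) (fmap (F n i) f) =
  fmap (F n.+1 i) (fmap (F n j.-1) f) \oc tau_nat i j x.
Proof. by move=> ij; rewrite !(tau_natE ij); apply: (ni_natural (tau C ij)). Qed.

Lemma tau_nat_cocycle (n i j k : nat) (x : C n) :
  (i < j)%N -> (j < k <= n.+3)%N ->
  fmap (F n.+2 i) (tau_nat j.-1 k.-1 x) \oc
    (tau_nat i k (F n j.-1 x) \oc fmap (F n.+2 k) (tau_nat i j x)) =
  tau_nat i j (F n k.-2 x) \oc
    (fmap (F n.+2 j) (tau_nat i k.-1 x) \oc tau_nat j k (F n i x)).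
Proof.
move=> ij jk.
have [ij1 ik1] : (i < j <= n.+2)%N /\ (i < k.-1 <= n.+2)%N by lia.
have [jk1 ij'] : (j.-1 < k.-1 <= n.+2)%N /\ (i < j <= n.+3)%N by lia.
have ik : (i < k <= n.+3)%N by lia.
rewrite (tau_natE ij1) (tau_natE ik1) (tau_natE jk1) (tau_natE ij').
rewrite (tau_natE ik) (tau_natE jk).
exact: (tau_cocycle ij1 ik1 jk1 ij' ik jk x).
Qed.

Variable X : C 0%N.

Local Notation Z n := (cofaces C (zero_tuple n) X).

(** The index [i] passes the inner zeros one by one, dropping by 1 each time, until it is 0. Only
    [i = n + 1] reaches degree 0 with index 1, where [phi] is used; larger indices are out of
    range. *)
Fixpoint contract_nat (n : nat) : forall i, hom (F n i (Z n)) (Z n.+1) :=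
  match n return forall i, hom (F n i (Z n)) (Z n.+1) with
  | 0 => fun i => match i return hom (F 0 i (Z 0)) (Z 1) with
    | 0 => idm _
    | 1 => ni_fun (phi C) X
    | _ => 0
    end
  | m.+1 => fun i => match i return hom (F m.+1 i (Z m.+1)) (Z m.+2) with
    | 0 => idm _
    | i'.+1 => fmap (F m.+1 0) (contract_nat m i') \oc tau_nat 0 i'.+1 (Z m)
    end
  end.

Lemma contract_nat0 (n : nat) : contract_nat n 0 = idm _.
Proof. by case: n. Qed.

(** Induction on the degree: contracting two indices commutes with exchanging them. *)
Lemma contract_nat_tau (n i j : nat) :
  (i < j <= n.+2)%N ->
  contract_nat n.+1 j \oc fmap (F n.+1 j) (contract_nat n i) =
  contract_nat n.+1 i \oc fmap (F n.+1 i) (contract_nat n j.-1)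
    \oc tau_nat i j (Z n).
Proof.
elim: n i j => [|n IHn] [|i] [//|j] /andP[lt_ij le_jn].
- by rewrite contract_nat0 fmap1 compm1 comp1m.
(* In range only the pair (1, 2) has a positive smaller index; its identity is the hexagon. *)
- have [-> ->] : i = 0 /\ j = 1 by lia.
  have := phi_hexagon (e := C) X.
  rewrite /vcomp /whiskl -!(tau_natE _ X) /= => hexagon.
  by rewrite fmap1 comp1m -!compA -hexagon.
- by rewrite contract_nat0 fmap1 compm1 comp1m.
have le_in : (0 < j.+1 <= n.+3)%N by [].
rewrite [contract_nat n.+1 j.+1.-1]/=.
case: j lt_ij le_jn le_in => // j lt_ij le_jn le_in.
rewrite /= !fmapM -!compA.
rewrite (compA (tau_nat 0 j.+2 _)) tau_nat_natural //.
rewrite [in RHS](compA (tau_nat 0 i.+1 _)) tau_nat_natural //; last by lia.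
(* The cocycle at [(0, i + 1, j + 2)] brings both sides under coface 0, where the induction
   hypothesis applies. *)
rewrite -!compA -(tau_nat_cocycle (n := n) (i := 0)) //; last by lia.
rewrite !compA -!fmapM /= -IHn; last by lia.
by [].
Qed.

(** Tuples contain arbitrary ordinals, not syntactic [inord k]; the casts this requires stay hidden
    here. *)
Lemma contraction :
  {P : forall n (i : 'I_n.+2), hom (coface C n i (Z n)) (Z n.+1) |
    forall n i, (i < n.+2)%N -> P n (inord i) = contract_nat n i}.
Proof.
pose Q n := inord_family_ord
  (T := fun i => hom (coface C n i (Z n)) (Z n.+1)) (contract_nat n).
by exists (fun n => sval (Q n)) => n; apply: (svalP (Q n)).
Qed.

(* The component at X of the isomorphism called N_s above. *)
Fixpoint collapse (n : nat) : forall s : ctuple n, hom (cofaces C s X) (Z n) :=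
  match n return forall s : ctuple n, hom (cofaces C s X) (Z n) with
  | 0 => fun s => idm X
  | m.+1 => fun s =>
      sval contraction m s.2 \oc fmap (coface C m s.2) (collapse s.1)
  end.

Lemma collapse_zero (n : nat) : collapse (zero_tuple n) = idm _.
Proof.
elim: n => //= n ->.
by rewrite (svalP contraction) // contract_nat0 fmap1 comp1m.
Qed.

Definition coherent (n : nat) (s t : ctuple n)
    (a : hom (cofaces C s X) (cofaces C t X)) :=
  collapse t \oc a = collapse s.

(** For [tau], naturality carries the collapse of the common inner tuple across, leaving
    [contract_nat_tau]. *)
Lemma elementary_coherent (n : nat) (s t : ctuple n)
    (a : transf (cofaces C s) (cofaces C t)) :
  elementary a -> coherent (a X).
Proof.
elim=> {n s t a} [n i j s ij | | n s t a i _ IHa].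
- rewrite /coherent /whiskr /= !(svalP contraction); try lia.
  rewrite !fmapM -!compA -(tau_natE ij).
  rewrite -tau_nat_natural // !compA; congr (_ \oc _).
  by rewrite -contract_nat_tau.
- rewrite /coherent /= !(svalP contraction) // contract_nat0.
  by rewrite fmap1 comp1m fmap1 compm1 comp1m.
- by rewrite /coherent /whiskl /= -compA -fmapM IHa.
Qed.

Lemma canonical_coherent (n : nat) (s t : ctuple n)
    (a : transf (cofaces C s) (cofaces C t)) :
  canonical a -> coherent (a X).
Proof.
elim=> {t a} [|t u a b _ IHa|t u a b b' _ IHa] /=; rewrite /coherent.
- by rewrite compm1.
- by move=> /elementary_coherent IHb; rewrite compA IHb.
- move=> /elementary_coherent IHb /(_ X)[_ bb'].
  by rewrite compA -IHb -(compA _ (b X)) bb' compm1.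
Qed.

(** [collapse t] is monic: by coherence and [collapse_zero] it is itself a component of a canonical
    isomorphism. *)
Lemma coherent_unique (n : nat) (s t : ctuple n)
    (a b : hom (cofaces C s X) (cofaces C t X)) :
  coherent a -> coherent b -> a = b.
Proof.
have := canonical_coherent (tauphiP C t (zero_tuple n)).
rewrite /coherent collapse_zero comp1m => <-.
have [_ [c /(_ X) inv]] := canonical_iso (tauphiP C t (zero_tuple n)).
by move=> + eq_b; rewrite -eq_b; apply: mutually_inverse_mono inv.
Qed.

End Coherence.

(** * Calculus of canonical isomorphisms along morphisms of C^0 *)

Section Transport.
Variables (K : fieldType) (C : enhanced_cosemi2 K).

(** Identities [u] give the isomorphisms in [delta], other [u] the comparison between objects; one
    composition law then serves both. *)
Definition transport (n : nat) (s t : ctuple n) (x y : C 0%N) (u : hom x y) :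
    hom (cofaces C s x) (cofaces C t y) :=
  ni_fun (tauphi C s t) y \oc fmap (cofaces C s) u.

Lemma tauphi_coherent (n : nat) (s t : ctuple n) (x : C 0%N) :
  coherent (ni_fun (tauphi C s t) x).
Proof. exact/canonical_coherent/tauphiP. Qed.

Lemma tauphi_transport (n : nat) (s t : ctuple n) (x : C 0%N) :
  ni_fun (tauphi C s t) x = transport s t (idm x).
Proof. by rewrite /transport fmap1 compm1. Qed.

Lemma coherent_transport (n : nat) (s t : ctuple n) (x : C 0%N)
    (a : hom (cofaces C s x) (cofaces C t x)) :
  coherent a -> a = transport s t (idm x).
Proof.
move=> coh_a; rewrite -tauphi_transport.
exact: coherent_unique coh_a (tauphi_coherent s t x).
Qed.

Lemma transport_id (n : nat) (s : ctuple n) (x : C 0%N) :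
  transport s s (idm x) = idm _.
Proof. by apply: esym; apply: coherent_transport; rewrite /coherent compm1. Qed.

Lemma transport_comp (n : nat) (s t r : ctuple n) (x y z : C 0%N)
    (v : hom y z) (u : hom x y) :
  transport t r v \oc transport s t u = transport s r (v \oc u).
Proof.
rewrite /transport fmapM !compA; congr (_ \oc _).
rewrite -!compA -(ni_natural (tauphi C s t)) compA; congr (_ \oc _).
rewrite [RHS]tauphi_transport; apply: coherent_transport.
by rewrite /coherent compA !tauphi_coherent.
Qed.

Lemma fmap_transport (n : nat) (i : 'I_n.+2) (s t : ctuple n) (x y : C 0%N)
    (u : hom x y) :
  fmap (coface C n i) (transport s t u) =
  transport (n := n.+1) (s, i) (t, i) u.
Proof.
rewrite /transport fmapM; congr (_ \oc _).
rewrite [RHS]tauphi_transport.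
apply: (@coherent_transport n.+1 (s, i) (t, i) y).
by rewrite /coherent /= -compA -fmapM tauphi_coherent.
Qed.

(** This is tau_{i,j+1}, retyped from [inord] indices to the ordinals of [sum_cosimplicial_eq0]. *)
Lemma coface_swap (n : nat) (i j : 'I_n.+2) : (i <= j)%N ->
  exists t : natiso (compF (coface C n.+1 (lift ord0 j)) (coface C n i))
                    (compF (coface C n.+1 (widen_ord (leqnSn _) i))
                           (coface C n j)),
    forall (s : ctuple n) (x : C 0%N),
    ni_fun t (cofaces C s x) =
    transport (n := n.+2) ((s, i), lift ord0 j)
                          ((s, j), widen_ord (leqnSn _) i) (idm x).
Proof.
move=> le_ij; have ij : (i < j.+1 <= n.+2)%N by rewrite ltnS le_ij ltn_ord.
have -> : lift ord0 j = inord j.+1.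
  by apply: val_inj; rewrite /= inordK // ltnS ltn_ord.
have -> : widen_ord (leqnSn n.+2) i = inord i.
  by apply: val_inj; rewrite /= inordK // ltnS ltnW.
have := fun s => elem_tau C s ij.
move: (tau C ij); rewrite /= !inord_val => t elem_t; exists t => s x.
have coh := elementary_coherent x (elem_t s).
exact: (@coherent_transport n.+2 (s, i, inord j.+1) (s, j, inord i) x _ coh).
Qed.

(** * The differential: square zero and independence of choices *)

Lemma alpha_transport (X : C 0%N) (nu : forall n, ctuple n) (n : nat)
    (i : 'I_n.+3) :
  alpha X nu i = transport (n := n.+2) (nu n.+1, i) (nu n.+2) (idm X).
Proof. exact: (@tauphi_transport n.+2 (nu n.+1, i) (nu n.+2) X). Qed.

Lemma beta_transport (X : C 0%N) (mu : forall n, ctuple n) (n : nat)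
    (i : 'I_n.+3) :
  beta X mu i = transport (n := n.+2) (mu n.+2) (mu n.+1, i) (idm X).
Proof. exact: (@tauphi_transport n.+2 (mu n.+2) (mu n.+1, i) X). Qed.

Lemma deltaE (X : C 0%N) (mu nu : forall n, ctuple n) (n : nat)
    (f : refhom X mu nu n.+1) :
  delta X mu nu n f = \sum_(i < n.+3) (-1) ^+ i *:
    sandwich (transport (n := n.+2) (nu n.+1, i) (nu n.+2) (idm X))
             (transport (n := n.+2) (mu n.+2) (mu n.+1, i) (idm X))
             (fmap (coface C n.+1 i) f).
Proof. by apply: eq_bigr => i _; rewrite alpha_transport beta_transport. Qed.

Lemma delta_linear (X : C 0%N) (mu nu : forall n, ctuple n) (n : nat) :
  linear (delta X mu nu n).
Proof.
move=> k f g; rewrite !deltaE scaler_sumr -big_split; apply: eq_bigr => i _ /=.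
by rewrite !linearP.
Qed.

Lemma delta_square (X : C 0%N) (mu nu : forall n, ctuple n) (n : nat)
    (f : refhom X mu nu n.+1) :
  delta X mu nu n.+1 (delta X mu nu n f) = 0.
Proof.
pose G (i : 'I_n.+3) (j : 'I_n.+4) :=
  sandwich (transport (n := n.+3) ((nu n.+1, i), j) (nu n.+3) (idm X))
           (transport (n := n.+3) (mu n.+3) ((mu n.+1, i), j) (idm X))
           (fmap (coface C n.+2 j) (fmap (coface C n.+1 i) f)).
transitivity (\sum_(j < n.+4) \sum_(i < n.+3) (-1) ^+ (i + j) *: G i j).
  rewrite deltaE; apply: eq_bigr => j _.
  rewrite deltaE !linear_sum; apply: eq_bigr => i _ /=.
  rewrite !linearZ /= scalerA -exprD; congr (_ *: _).
  rewrite fmap_sandwich (@fmap_transport n.+2 j (nu n.+1, i) (nu n.+2)).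
  rewrite (@fmap_transport n.+2 j (mu n.+2) (mu n.+1, i)) sandwich_comp.
  rewrite (@transport_comp n.+3 (nu n.+1, i, j) (nu n.+2, j) (nu n.+3)).
  rewrite (@transport_comp n.+3 (mu n.+3) (mu n.+2, j) (mu n.+1, i, j)).
  by rewrite !comp1m.
apply: sum_cosimplicial_eq0 => i j le_ij; rewrite /G /sandwich.
have [t tE] := coface_swap le_ij; set w := widen_ord _ i in t tE *.
(* Both outer transports factor through [t], on the left for [nu] and on the right for [mu];
   naturality of [t] at [f] then identifies the two terms. *)
have := @transport_comp n.+3 (nu n.+1, i, lift ord0 j) (nu n.+1, j, w)
  (nu n.+3) X X X (idm X) (idm X).
have := @transport_comp n.+3 (mu n.+3) (mu n.+1, i, lift ord0 j)
  (mu n.+1, j, w) X X X (idm X) (idm X).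
rewrite !comp1m => <- <-; rewrite -!tE -!compA; congr (_ \oc (_ \oc _)).
rewrite [LHS]compA [RHS]compA; congr (_ \oc _); exact: (ni_natural t f).
Qed.

Lemma delta_isomorphic (X Y : C 0%N) (u : hom X Y) (v : hom Y X)
    (mu nu mu' nu' : forall n, ctuple n) :
  mutually_inverse u v ->
  cochain_isomorphic
    (M := fun n => refhom X mu nu n.+1) (delta X mu nu)
    (N := fun n => refhom Y mu' nu' n.+1) (delta Y mu' nu').
Proof.
move=> [vu uv].
(* Hom is contravariant in its source, so precomposition goes backwards, along [v]. *)
pose h n : {linear refhom X mu nu n.+1 -> refhom Y mu' nu' n.+1} :=
  sandwich (transport (nu n.+1) (nu' n.+1) u)
           (transport (mu' n.+1) (mu n.+1) v).
exists h; split=> n.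
  exists (sandwich (transport (nu' n.+1) (nu n.+1) v)
                   (transport (mu n.+1) (mu' n.+1) u)) => f;
  by rewrite /= sandwich_comp !transport_comp ?vu ?uv !transport_id
             /sandwich comp1m compm1.
move=> f; rewrite !deltaE linear_sum; apply: eq_bigr => i _.
rewrite linearZ; congr (_ *: _).
rewrite /= fmap_sandwich.
rewrite (@fmap_transport n.+1 i (nu n.+1) (nu' n.+1)).
rewrite (@fmap_transport n.+1 i (mu' n.+1) (mu n.+1)) !sandwich_comp.
rewrite (@transport_comp n.+2 (nu n.+1, i) (nu n.+2) (nu' n.+2)).
rewrite (@transport_comp n.+2 (mu' n.+2) (mu n.+2) (mu n.+1, i)).
rewrite (@transport_comp n.+2 (nu n.+1, i) (nu' n.+1, i) (nu' n.+2)).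
rewrite (@transport_comp n.+2 (mu' n.+2) (mu' n.+1, i) (mu n.+1, i)).
by rewrite !comp1m !compm1.
Qed.

End Transport.

(* Index n below is cochain degree n + 1: the complexes start in degree 1. *)
Theorem theorem5p4 (K : fieldType) (C : enhanced_cosemi2 K) (X : C 0%N) :
  (forall mu nu : forall n, ctuple n,
     is_cochain_complex (M := fun n => refhom X mu nu n.+1) (delta X mu nu)) /\
  (forall (Y : C 0%N), isomorphic X Y ->
   forall mu nu mu' nu' : forall n, ctuple n,
     cochain_isomorphic
       (M := fun n => refhom X mu nu n.+1) (delta X mu nu)
       (N := fun n => refhom Y mu' nu' n.+1) (delta Y mu' nu')).
Proof.
split=> [mu nu | Y [u [v uv]] mu nu mu' nu'].
  by split=> n; [apply: delta_linear | apply: delta_square].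
exact: delta_isomorphic uv.
Qed.
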